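(* Let $d\in\mathbb{N}$ and $p\in\mathcal{D}_d$. If $k\to\infty$ and $b\to\infty$ ($k,b$ positive integers), then $\min_{q\in\mathcal{H}_{d,b}^k}\|p-q\|_1\to 0$.
   Context: $\mathbb{N}$ denotes the positive integers and $[b]=\{1,\ldots,b\}$. $\mathcal{D}_d$ is the set of all probability densities on $[0,1)^d$ (with respect to $d$-dimensional Lebesgue measure); $\|\cdot\|_1$ is the $L^1$ norm. $\Delta_k$ is the set of vectors in $\mathbb{R}^k$ with nonnegative entries summing to one. For $i\in[b]$, let $h_{1,b,i}(x)=b\,\mathbf{1}\left(\frac{i-1}{b}\le x<\frac{i}{b}\right)$ on $[0,1)$, and let $\mathcal{H}_{1,b}$ be the convex hull of $\{h_{1,b,i}: i\in[b]\}$. For univariate functions, $\prod_{j=1}^d p_j$ denotes $(x_1,\ldots,x_d)\mapsto\prod_{j=1}^d p_j(x_j)$. The set of multi-view histograms is $$\mathcal{H}_{d,b}^k=\left\{\sum_{i=1}^k w_i\prod_{j=1}^d p_{i,j}\;:\; w\in\Delta_k,\ p_{i,j}\in\mathcal{H}_{1,b}\right\}.$$ *)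

(* Defs.v *)
From HB Require Import structures.
From mathcomp Require Import all_boot all_order all_algebra.
From mathcomp Require Import all_classical all_reals all_analysis.

Set Implicit Arguments.
Unset Strict Implicit.
Unset Printing Implicit Defensive.

Import Order.TTheory GRing.Theory Num.Theory.
Import numFieldNormedType.Exports.

Local Open Scope classical_set_scope.
Local Open Scope ring_scope.

(* R^d as the d-fold product of the Borel sigma-algebra of R. *)
Notation euclid R d := (d.-tuple (measurableTypeR R)).

Section lebesgue_tuple.
Context (R : realType).
Local Open Scope ereal_scope.

Definition cons_pair n (x : measurableTypeR R * euclid R n) : euclid R n.+1 :=
  [tuple of x.1 :: x.2].

Definition uncons n (t : euclid R n.+1) : measurableTypeR R * euclid R n :=
  (thead t, [tuple of behead t]).

(* The d-dimensional Lebesgue measure, as an iterated product of the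
   one-dimensional one. *)
Fixpoint lebesgue_tuple (n : nat) : set (euclid R n) -> \bar R :=
  match n with
  | 0 => \d_([tuple] : euclid R 0)
  | n.+1 => pushforward (lebesgue_measure \x @lebesgue_tuple n) (@cons_pair n)
  end.

Lemma cons_pairK n : cancel (@cons_pair n) (@uncons n).
Proof. by case=> x t; congr pair; apply/val_inj. Qed.

Lemma unconsK n : cancel (@uncons n) (@cons_pair n).
Proof. by move=> t; rewrite [RHS]tuple_eta; apply/val_inj. Qed.

Lemma measurable_cons_pair n : measurable_fun setT (@cons_pair n).
Proof. exact: (measurable_cons measurable_fst measurable_snd). Qed.

Lemma measurable_uncons n : measurable_fun setT (@uncons n).
Proof.
apply/measurable_fun_pairP; split; last exact: measurable_behead.
exact: (@measurable_tnth _ (measurableTypeR R) n.+1 ord0).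
Qed.

(* This holds in the library, but as a canonical instance shadowed by the one
   for subprobabilities. *)
Lemma sigma_finite_product d1 d2 (T1 : measurableType d1)
    (T2 : measurableType d2) (m1 : {sigma_finite_measure set T1 -> \bar R})
    (m2 : {sigma_finite_measure set T2 -> \bar R}) :
  sigma_finite setT (m1 \x m2).
Proof.
have /sigma_finiteP[F [TF ndF Foo]] := sigma_finiteT m1.
have /sigma_finiteP[G [TG ndG Goo]] := sigma_finiteT m2.
exists (fun n => F n `*` G n).
  apply/seteqP; split=> // -[x y] _.
  have [n _ Fx] : (\bigcup_n F n) x by rewrite -TF.
  have [m _ Gy] : (\bigcup_m G m) y by rewrite -TG.
  exists (maxn n m) => //; split.
    by move: x Fx; exact/subsetPset/ndF/leq_maxl.
  by move: y Gy; exact/subsetPset/ndG/leq_maxr.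
move=> k; have [? ?] := Foo k; have [? ?] := Goo k.
split; first exact: measurableX.
by rewrite product_measure1E// lte_mul_pinfty// ge0_fin_numE.
Qed.

Lemma lebesgue_tuple_sigma_finite_measure n :
  exists mu : {sigma_finite_measure set (euclid R n) -> \bar R},
    mu = @lebesgue_tuple n :> (set _ -> \bar R).
Proof.
elim: n => [|n [mu muE]] /=.
  by exists (\d_([tuple] : euclid R 0) :
    {finite_measure set (euclid R 0) -> \bar R}).
rewrite -muE.
pose nu : {measure set (euclid R n.+1) -> \bar R} :=
  measure_function_pushforward__canonical__measure_function_Measure
    (lebesgue_measure \x mu) (@measurable_cons_pair n).
have nu_sf : sigma_finite setT nu.
  have [F FT Ffin] := sigma_finite_product lebesgue_measure mu.
  exists (fun i => @uncons n @^-1` F i).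
    by rewrite -preimage_bigcup -FT preimage_setT.
  move=> i; have [mF Foo] := Ffin i; split.
    by rewrite -[X in measurable X]setTI; exact: measurable_uncons.
  suff -> : nu (@uncons n @^-1` F i) = (lebesgue_measure \x mu) (F i) by [].
  rewrite /nu /= /pushforward; congr product_measure1.
  by apply/funext => x /=; rewrite cons_pairK.
pose bld := Measure_isSigmaFinite.Build _ _ _ nu nu_sf.
pose mu' : {sigma_finite_measure set (euclid R n.+1) -> \bar R} :=
  HB.pack (Measure.sort nu) (Measure.class nu) bld.
by exists mu'.
Qed.

Section instances.
Variable n : nat.

Let lebesgue_tuple0 : @lebesgue_tuple n set0 = 0.
Proof. by have [mu <-] := lebesgue_tuple_sigma_finite_measure n. Qed.

Let lebesgue_tuple_ge0 A : 0 <= @lebesgue_tuple n A.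
Proof. by have [mu <-] := lebesgue_tuple_sigma_finite_measure n. Qed.

Let lebesgue_tuple_sigma_additive : semi_sigma_additive (@lebesgue_tuple n).
Proof.
have [mu <-] := lebesgue_tuple_sigma_finite_measure n.
exact: measure_semi_sigma_additive.
Qed.

HB.instance Definition _ := isMeasure.Build _ _ _ (@lebesgue_tuple n)
  lebesgue_tuple0 lebesgue_tuple_ge0 lebesgue_tuple_sigma_additive.

Let lebesgue_tuple_sigma_finite : sigma_finite setT (@lebesgue_tuple n).
Proof.
have [mu <-] := lebesgue_tuple_sigma_finite_measure n.
exact: sigma_finiteT.
Qed.

HB.instance Definition _ := Measure_isSigmaFinite.Build _ _ _
  (@lebesgue_tuple n) lebesgue_tuple_sigma_finite.

End instances.

Lemma lebesgue_tuple_box n (A : 'I_n -> set (measurableTypeR R)) :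
  (forall i, measurable (A i)) ->
  @lebesgue_tuple n [set t | forall i, A i (tnth t i)] =
  \prod_(i < n) lebesgue_measure (A i).
Proof.
elim: n A => [|n IH] A mA /=.
  by rewrite big_ord0 diracE mem_set//= => -[].
rewrite big_ord_recl -IH // /pushforward -product_measure1E //; last first.
  rewrite (_ : [set t | _] = \bigcap_(i in [set: 'I_n])
      ((fun t : euclid R n => tnth t i) @^-1` A (lift ord0 i))).
    apply: fin_bigcap_measurable => // i _.
    by rewrite -[X in measurable X]setTI; apply: measurable_tnth.
  by apply/seteqP; split => [t /= h i _|t h i]; [exact: h|exact: h].
congr product_measure1; apply/seteqP; split => [[x t] /= h|[x t] /= [h0 h] i].
  split; first exact: (h ord0).
  by move=> i; have := h (lift ord0 i); rewrite /cons_pair/= tnthS.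
have [->|] := eqVneq i ord0; first exact: h0.
by case: (unliftP ord0 i) => [j -> _|->]; rewrite ?eqxx// /cons_pair tnthS.
Qed.

End lebesgue_tuple.

Section histograms.
Context (R : realType).

Definition unit_cube d : set (euclid R d) :=
  [set x | forall j, 0 <= (tnth x j : R) < 1].
Arguments unit_cube d : clear implicits.

Lemma measurable_unit_cube d : measurable (unit_cube d).
Proof.
rewrite (_ : unit_cube d = \bigcap_(j in [set: 'I_d])
    ((fun x : euclid R d => tnth x j) @^-1` `[0, 1[%classic)).
  apply: fin_bigcap_measurable => // j _.
  rewrite -[X in measurable X]setTI.
  by apply: measurable_tnth => //; exact: measurable_itv.
apply/seteqP; split=> [x /= h j _|x h j]; first by rewrite /= in_itv; exact: h.
by have := h j I; rewrite /= in_itv.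
Qed.

Definition density d : set (euclid R d -> R) :=
  [set p : euclid R d -> R | [/\ measurable_fun (unit_cube d) p,
     forall x, unit_cube d x -> 0 <= p x &
     (\int[@lebesgue_tuple R d]_(x in unit_cube d) (p x)%:E = 1)%E]].
Arguments density d : clear implicits.

Definition L1_norm d (f : euclid R d -> R) : \bar R :=
  'N[@lebesgue_tuple R d]_1[EFin \o (f \_ (unit_cube d))]%E.

Definition simplex k : set 'rV[R]_k :=
  [set w | (forall i, 0 <= w 0 i) /\ \sum_i w 0 i = 1].

Definition convex_hull (V : lmodType R) (A : set V) : set V :=
  [set v | exists n (w : 'rV[R]_n) (a : 'I_n -> V),
     [/\ simplex w, forall i, A (a i) & v = \sum_i w 0 i *: a i]].

(* The cells are numbered from 0 instead of 1.  All univariate densities below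
   are functions on R that vanish outside [0, 1). *)
Definition hist_cell b (i : 'I_b) : R -> R^o :=
  fun x => b%:R * \1_(`[i%:R / b%:R, i.+1%:R / b%:R[) x.

Definition hist1 b : set (R -> R^o) := convex_hull (range (@hist_cell b)).

Definition hist d b k : set (euclid R d -> R) :=
  [set q | exists (w : 'rV[R]_k) (p : 'I_k -> 'I_d -> R -> R),
     [/\ simplex w, forall i j, hist1 b (p i j) &
         q = fun x => \sum_i w 0 i * \prod_j p i j (tnth x j)]].

End histograms.
Arguments unit_cube {R} d.
Arguments density {R} d.
Arguments hist1 {R} b.
Arguments hist {R} d b k.

(* Main.v *)
Require Import Defs.
From mathcomp Require Import all_boot all_order all_algebra.
From mathcomp Require Import all_classical all_reals all_analysis.
From mathcomp Require Import measurable_realfun.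
From mathcomp Require Import lra.

(** Fix a density p on the unit cube and cut the cube into N^d equal cells.

    Existence of the minimum.  On the cube a multi-view histogram with b bins
    is constant on the b^d cells, and its values there are polynomials in the
    mixture weights and in the bin weights (multiview_valueE).  These parameters
    range over a product of simplices, which is compact, and the L1 error moves
    by at most the largest change of a cell value (L1_norm_sub_grid_le), so it
    is a continuous function of the parameters (continuous_grid_error) and
    attains its minimum (hist_min).

    Convergence to 0.  There are two approximations.

    - p is an L1 limit of grid functions, that is of functions constant on the
      cells (density_approximable).  The sets whose indicator has this property
      form a sigma-algebra (grid_approximable_sigma_algebra), which contains the
      half-spaces and hence all Borel sets; simple functions then reach every
      integrable function.  Truncating at 0 and normalising turns a grid
      function close to p into a grid density (density_grid_approx), which is a
      mixture of N^d products of univariate cell densities.  So N^d components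
      and bins of width 1/N suffice.

    - The number b of bins is arbitrary and need not be a multiple of N.  But
      with N fixed, the density of an interval [i/N, (i+1)/N) is reproduced
      exactly by a histogram with b bins except within distance 1/b of the
      points t/N, without exceeding the height N (hist1_approx_cell).  Replacing
      every factor in this way changes the mixture by at most N^d on a union of
      slabs of total measure O(1/b) (hist_approx_grid).

    Components with weight zero take care of all k above N^d
    (hist_weights). *)

Import Order.TTheory GRing.Theory Num.Theory.
Import numFieldNormedType.Exports.

Local Open Scope classical_set_scope.
Local Open Scope ring_scope.

(** * Cells of the uniform grids *)

Section cells.
Set Implicit Arguments.
Unset Strict Implicit.
Context (R : realType).

(** The grids are indexed by n with n.+1 cells per axis, so that the index type
    is never empty; the default value of inord is only met outside [0, 1). *)
Definition cell_index n (x : R) : 'I_n.+1 := inord (Num.truncn (n.+1%:R * x)).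

Lemma cell_indexE n x (l : 'I_n.+1) : 0 <= x < 1 ->
  (cell_index n x == l) = (l%:R / n.+1%:R <= x < l.+1%:R / n.+1%:R).
Proof.
move=> /andP[x0 x1]; have n0 : 0 < n.+1%:R :> R by rewrite ltr0n.
have nx0 : 0 <= n.+1%:R * x by rewrite mulr_ge0// ler0n.
rewrite ler_pdivrMr// ltr_pdivlMr// [x * _]mulrC.
rewrite -val_eqE /= inordK ?truncn_eq//.
rewrite -(ltr_nat R); have /andP[+ _] := truncn_itv nx0.
by move/le_lt_trans; apply; rewrite gtr_pMr.
Qed.

Lemma cell_index_itv n (x : R) : 0 <= x < 1 ->
  (cell_index n x)%:R / n.+1%:R <= x <
  (cell_index n x)%:R / n.+1%:R + n.+1%:R^-1.
Proof.
by move=> x01; rewrite -[X in _ < _ + X]mul1r -mulrDl natr1 -cell_indexE.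
Qed.

Lemma hist_cellE n x (l : 'I_n.+1) : 0 <= x < 1 ->
  hist_cell l x = n.+1%:R * (cell_index n x == l)%:R.
Proof.
by move=> x01; rewrite /hist_cell indicE cell_indexE// mem_setE in_itv.
Qed.

Context (d : nat).
Local Notation mu := (@lebesgue_tuple R d).
Local Notation D := (@unit_cube R d).

Definition grid n (x : euclid R d) : {ffun 'I_d -> 'I_n.+1} :=
  [ffun j => cell_index n (tnth x j)].

Lemma measurable_slab (j : 'I_d) (A : set (measurableTypeR R)) : measurable A ->
  measurable [set x : euclid R d | A (tnth x j)].
Proof.
move=> mA; rewrite -[X in measurable X]setTI.
exact: (@measurable_tnth _ (measurableTypeR R) d j measurableT A mA).
Qed.

Lemma lebesgue_cube : mu D = 1%E.
Proof.
rewrite (_ : D = [set t | forall i, `[0, 1[%classic (tnth t i)]).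
  rewrite (@lebesgue_tuple_box R d (fun=> `[0, 1[%classic)); last first.
    by move=> i; exact: measurable_itv.
  by rewrite big1// => i _; rewrite lebesgue_measure_itv/= lte_fin ltr01 sube0.
by apply/seteqP; split=> x /= h j; have := h j; rewrite in_itv.
Qed.

(** A function of the coordinates and a grid function that imitates it will
    differ on finitely many thin slabs only; this bounds their measure. *)
Lemma lebesgue_slab (j : 'I_d) (a b : R) : a <= b ->
  (mu (D `&` [set x | (a <= tnth x j < b)%R]) <= (b - a)%:E)%E.
Proof.
move=> ab.
have mI (u v : R) : measurable (`[u, v[%classic : set (measurableTypeR R)).
  exact: measurable_itv.
pose A i : set (measurableTypeR R) :=
  if i == j then `[a, b[%classic else `[0, 1[%classic.
have mA i : measurable (A i) by rewrite /A; case: ifP.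
apply: (@le_trans _ _ (mu [set t | forall i, A i (tnth t i)])).
  apply: le_measure; rewrite ?inE.
  - apply: measurableI; first exact: measurable_unit_cube.
    rewrite (_ : [set x | _] = [set x | `[a, b[%classic (tnth x j)]).
      exact: measurable_slab.
    by apply/seteqP; split=> x /=; rewrite in_itv.
  - rewrite (_ : [set t | _] =
       \bigcap_(i in [set: 'I_d]) [set x | A i (tnth x i)]).
      by apply: fin_bigcap_measurable => // i _; exact: measurable_slab.
    by apply/seteqP; split=> [x /= h i _|x h i]; exact: h.
  - move=> x /= [Dx ax] i; rewrite /A; case: ifP => [/eqP ->|_] /=.
      by rewrite in_itv.
    by rewrite in_itv; exact: Dx.
rewrite lebesgue_tuple_box// (bigD1 j)//= big1 ?mule1 /A.
  rewrite eqxx lebesgue_measure_itv/= lte_fin; case: ifPn => //.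
  by rewrite lee_fin subr_ge0.
move=> i /negbTE ->.
by rewrite lebesgue_measure_itv/= lte_fin ltr01 sube0.
Qed.

Lemma measurable_grid n (C : set {ffun 'I_d -> 'I_n.+1}) :
  measurable (D `&` grid n @^-1` C).
Proof.
rewrite (_ : D `&` _ = \bigcup_(c in C) (D `&`
    \bigcap_(j in [set: 'I_d]) [set x | `[(c j)%:R / n.+1%:R,
      (c j).+1%:R / n.+1%:R[%classic (tnth x j)])).
  apply: fin_bigcup_measurable; first exact: finite_finset.
  move=> c _; apply: measurableI; first exact: measurable_unit_cube.
  by apply: fin_bigcap_measurable => // j _; exact: measurable_slab.
apply/seteqP; split=> x /=.
  move=> [Dx Cx]; exists (grid n x) => //; split=> // j _ /=.
  by rewrite in_itv ffunE/= -cell_indexE//; exact: Dx.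
move=> [c Cc [Dx /= h]]; split=> //.
suff -> : grid n x = c by [].
apply/ffunP => j; rewrite ffunE; apply/eqP; rewrite cell_indexE; last exact: Dx.
by have := h j I; rewrite /= in_itv.
Qed.

(** A grid function is v (grid n x) for an arbitrary v on the finite set of
    cells, which makes the class stable under all pointwise operations. *)
Lemma measurable_fun_grid n (v : {ffun 'I_d -> 'I_n.+1} -> R) :
  measurable_fun D (fun x => v (grid n x)).
Proof. by move=> _ Y mY; exact: (measurable_grid (v @^-1` Y)). Qed.

End cells.

(** * The L1 norm on the unit cube *)

Section L1.
Set Implicit Arguments.
Unset Strict Implicit.
Context (R : realType) (d : nat).
Local Notation mu := (@lebesgue_tuple R d).
Local Notation D := (@unit_cube R d).
Local Notation mD := (@measurable_unit_cube R d).
Implicit Types f g h : euclid R d -> R.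

Lemma L1_normE f : L1_norm f = (\int[mu]_(x in D) `|f x|%:E)%E.
Proof.
rewrite /L1_norm Lnorm1 [RHS]integral_mkcond; apply: eq_integral => x _ /=.
by rewrite !patchE; case: ifP => _ //; rewrite normr0.
Qed.

Lemma measurable_normE f : measurable_fun D f ->
  measurable_fun D (EFin \o (fun x => `|f x|)).
Proof. by move=> mf; apply/measurable_EFinP; exact: measurableT_comp. Qed.

(** Pointwise domination by two functions covers at once the triangle
    inequality and the operations that are nonexpansive in each argument. *)
Lemma L1_normD f g h : measurable_fun D f -> measurable_fun D g ->
    measurable_fun D h -> (forall x, D x -> `|f x| <= `|g x| + `|h x|) ->
  (L1_norm f <= L1_norm g + L1_norm h)%E.
Proof.
move=> mf mg mh fgh; rewrite !L1_normE -ge0_integralD//; first last.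
- exact: measurable_normE.
- exact: measurable_normE.
- exact: mD.
apply: ge0_le_integral => //; first exact: mD.
- exact: measurable_normE.
- apply: emeasurable_funD; exact: measurable_normE.
Qed.

Lemma L1_norm_le f g : measurable_fun D f -> measurable_fun D g ->
    (forall x, D x -> `|f x| <= `|g x|) -> (L1_norm f <= L1_norm g)%E.
Proof.
move=> mf mg fg; rewrite !L1_normE; apply: ge0_le_integral => //.
- exact: mD.
- exact: measurable_normE.
- exact: measurable_normE.
Qed.

Lemma L1_norm_cst (a : R) : @L1_norm R d (fun=> a) = `|a|%:E.
Proof. rewrite L1_normE; transitivity (`|a|%:E * mu D)%E; last first.
  by rewrite lebesgue_cube mule1.
exact: (integral_cst mu mD `|a|%:E). Qed.

Lemma L1_normZ (a : R) f : measurable_fun D f ->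
  L1_norm (fun x => a * f x) = (`|a|%:E * L1_norm f)%E.
Proof.
move=> mf; rewrite !L1_normE -ge0_integralZl//.
- by apply: eq_integral => x _; rewrite normrM EFinM.
- exact: mD.
- exact: measurable_normE.
Qed.

Lemma eq_L1_norm f g : (forall x, D x -> f x = g x) -> L1_norm f = L1_norm g.
Proof.
move=> fg; rewrite !L1_normE.
by apply: eq_integral => x /set_mem Dx; rewrite fg.
Qed.

Lemma L1_norm_indic (A : set (euclid R d)) : measurable A ->
  L1_norm (\1_A : euclid R d -> R) = mu (A `&` D).
Proof.
move=> mA; rewrite L1_normE -integral_indic//; last exact: mD.
by apply: eq_integral => x _; rewrite ger0_norm.
Qed.

Lemma L1_norm_sum (I : finType) (F : I -> euclid R d -> R) :
  (forall i, measurable_fun D (F i)) -> (forall i x, 0 <= F i x) ->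
  L1_norm (fun x => \sum_i F i x) = (\sum_i L1_norm (F i))%E.
Proof.
move=> mF F0; rewrite L1_normE.
under eq_bigr do rewrite L1_normE.
rewrite -ge0_integral_sum//; first last.
- by move=> i; exact: measurable_normE.
- exact: mD.
apply: eq_integral => x _; rewrite ger0_norm ?sumr_ge0// -sumEFin.
by apply: eq_bigr => i _; rewrite ger0_norm.
Qed.

Lemma cvge0_le (u : nat -> \bar R) (e : R) : u @ \oo --> 0%E -> 0 < e ->
  exists n, (u n <= e%:E)%E.
Proof.
move=> u0 e0.
have /u0 : nbhs (0%E : \bar R) [set y | (y < e%:E)%E].
  apply: open_nbhs_nbhs; split; first exact: open_ereal_lt_ereal.
  by rewrite /= lte_fin.
by case=> N _ h; exists N; apply: ltW; exact: (h N (leqnn N)).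
Qed.

End L1.

(** * Functions approximable by grid functions *)

Section grid_approximable.
Set Implicit Arguments.
Unset Strict Implicit.
Context (R : realType) (d : nat).
Local Notation mu := (@lebesgue_tuple R d).
Local Notation D := (@unit_cube R d).
Local Notation mD := (@measurable_unit_cube R d).
Implicit Types f g h : euclid R d -> R.

(** Asking for an approximation on every sufficiently fine grid, and not just
    on some grid, avoids common refinements when two functions are combined. *)
Definition grid_approximable f := measurable_fun D f /\
  forall e : R, 0 < e -> exists N, forall n, (N <= n)%N ->
    exists v : {ffun 'I_d -> 'I_n.+1} -> R,
      (L1_norm (fun x => f x - v (grid n x))%R <= e%:E)%E.

Lemma measurable_fun_sub_grid n f (v : {ffun 'I_d -> 'I_n.+1} -> R) :
  measurable_fun D f -> measurable_fun D (fun x => f x - v (grid n x)).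
Proof.
by move=> mf; apply: measurable_funB => //; exact: measurable_fun_grid.
Qed.

(** Applying op to the approximations of f and g approximates op f g; this
    serves for sums and for maxima. *)
Lemma grid_approximable_nonexpansive (op : R -> R -> R) f g :
    (forall a b a' b',
      `|op a b - op a' b'| <= `|a - a'| + `|b - b'|) ->
    measurable_fun D (fun x => op (f x) (g x)) ->
  grid_approximable f -> grid_approximable g ->
  grid_approximable (fun x => op (f x) (g x)).
Proof.
move=> lip mop [mf af] [mg ag]; split=> // e e0.
have e20 : 0 < e / 2 by rewrite divr_gt0.
have [N1 h1] := af _ e20; have [N2 h2] := ag _ e20.
exists (maxn N1 N2) => n; rewrite geq_max => /andP[/h1[v1 hv1] /h2[v2 hv2]].
exists (fun c => op (v1 c) (v2 c)).
rewrite (splitr e) EFinD; apply: le_trans (leeD hv1 hv2).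
apply: L1_normD.
- exact: (measurable_fun_sub_grid (fun c => op (v1 c) (v2 c))).
- exact: measurable_fun_sub_grid.
- exact: measurable_fun_sub_grid.
- by move=> x _; exact: lip.
Qed.

Lemma grid_approximable_cst (a : R) : grid_approximable (fun=> a).
Proof.
split=> [|e e0]; first exact: measurable_cst.
exists 0%N => n _; exists (fun=> a).
by rewrite subrr L1_norm_cst normr0 lee_fin ltW.
Qed.

Lemma grid_approximableD f g : grid_approximable f -> grid_approximable g ->
  grid_approximable (fun x => f x + g x).
Proof.
move=> af ag; apply: (@grid_approximable_nonexpansive +%R) => //.
- by move=> a b a' b'; rewrite opprD addrACA ler_normD.
- by apply: measurable_funD; [exact: af.1|exact: ag.1].
Qed.

Lemma grid_approximableZ (a : R) f : grid_approximable f ->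
  grid_approximable (fun x => a * f x).
Proof.
move=> [mf af]; split=> [|e e0]; first exact: measurable_funM.
have a0 : 0 < `|a| + 1 by rewrite ltr_wpDl.
have [N h] := af _ (divr_gt0 e0 a0).
exists N => n /h[v hv]; exists (fun c => a * v c).
under [X in L1_norm X]eq_fun do rewrite -mulrBr.
rewrite L1_normZ; last exact: measurable_fun_sub_grid.
apply: (le_trans (lee_wpmul2l _ hv)); first by rewrite lee_fin.
rewrite -EFinM lee_fin mulrCA ger_pMr// ler_pdivrMr// mul1r.
by rewrite lerDl.
Qed.

Lemma grid_approximable_sum (I : Type) (s : seq I) (F : I -> euclid R d -> R) :
  (forall i, grid_approximable (F i)) ->
  grid_approximable (fun x => \sum_(i <- s) F i x).
Proof.
move=> aF; elim: s => [|i s IH].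
  by under eq_fun do rewrite big_nil; exact: grid_approximable_cst.
by under eq_fun do rewrite big_cons; exact: grid_approximableD.
Qed.

Lemma grid_approximable_lim f : measurable_fun D f ->
    (forall e : R, 0 < e -> exists2 g, grid_approximable g &
      (L1_norm (fun x => f x - g x)%R <= e%:E)%E) ->
  grid_approximable f.
Proof.
move=> mf hf; split=> // e e0.
have e20 : 0 < e / 2 by rewrite divr_gt0.
have [g [mg ag] fg] := hf _ e20.
have [N h] := ag _ e20; exists N => n /h[v hv]; exists v.
rewrite (splitr e) EFinD; apply: le_trans (leeD fg hv).
apply: L1_normD.
- exact: measurable_fun_sub_grid.
- exact: measurable_funB.
- exact: measurable_fun_sub_grid.
- move=> x _; rewrite (_ : f x - _ = (f x - g x) + (g x - v (grid n x))).
    exact: ler_normD.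
  by rewrite addrA subrK.
Qed.

(** Measurability of A is part of the definition because the indicators of a
    countable union are compared through the measures of their differences. *)
Definition grid_approximable_set : set (set (euclid R d)) :=
  [set A | measurable A /\ grid_approximable (\1_A : euclid R d -> R)].

Lemma normr_maxrB (a b a' b' : R) :
  `|Num.max a b - Num.max a' b'| <= `|a - a'| + `|b - b'|.
Proof.
rewrite ler_norml; case: (leP a b) => ab; case: (leP a' b') => ab';
  have := ler_norm (a - a'); have := ler_norm (b - b');
  have := ler_norm (a' - a); have := ler_norm (b' - b);
  rewrite [`|a' - a|]distrC [`|b' - b|]distrC; lra.
Qed.

(** Complements and finite unions come from 1 - f and max f g.  A countable
    union is the L1 limit of its finite subunions, because the cube has finite
    measure and the remainders decrease to the empty set. *)
Lemma grid_approximable_sigma_algebra :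
  sigma_algebra setT grid_approximable_set.
Proof.
have mI (A : set (euclid R d)) : measurable A ->
    measurable_fun D (\1_A : euclid R d -> R).
  by move=> mA; exact: measurable_indic.
split.
- split=> //; rewrite (_ : \1_set0 = fun=> 0).
    exact: grid_approximable_cst.
  by apply/funext => x; rewrite indic0.
- move=> A [mA aA]; split; first by rewrite setTD; exact: measurableC.
  rewrite (_ : \1_(_) = fun x => 1 + (-1) * \1_A x).
    apply: grid_approximableD; first exact: grid_approximable_cst.
    exact: grid_approximableZ.
  apply/funext => x; rewrite setTD mulN1r !indicE in_setC.
  by case: (x \in A); rewrite /= ?subrr ?subr0.
- move=> F aF; pose U n := \big[setU/set0]_(i < n) F i.
  have mU n : measurable (U n).
    by apply: bigsetU_measurable => i _; exact: (aF i).1.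
  have aU n : grid_approximable (\1_(U n) : euclid R d -> R).
    elim: n => [|n IH].
      rewrite /U big_ord0 (_ : \1_set0 = fun=> 0).
        exact: grid_approximable_cst.
      by apply/funext => x; rewrite indic0.
    rewrite (_ : \1_(_) = fun x => Num.max (\1_(U n) x) (\1_(F n) x : R)).
      apply: (@grid_approximable_nonexpansive Num.max) => //.
      + exact: normr_maxrB.
      + by apply: measurable_maxr; apply: mI => //; exact: (aF n).1.
      + exact: (aF n).2.
    apply/funext => x; rewrite /U big_ord_recr /= !indicE in_setU.
    by case: (x \in _); case: (x \in _); rewrite maxEle /= ?lexx ?ler01 ?ler10.
  have mF : measurable (\bigcup_k F k).
    by apply: bigcupT_measurable => k; exact: (aF k).1.
  split=> //; apply: grid_approximable_lim; first exact: mI.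
  move=> e e0; pose G n := D `&` (\bigcup_k F k `\` U n).
  have mG n : measurable (G n).
    by apply: measurableI; [exact: mD|exact: measurableD].
  have G0 : \bigcap_n G n = set0.
    rewrite -subset0 => x /= Gx; have [_ [[k _ Fkx] _]] := Gx 0%N I.
    have [_ [_]] := Gx k.+1 I; apply.
    by rewrite /U -bigcup_mkord; exists k => /=.
  have /cvge0_le/(_ e0)[n Gn] : mu (G n) @[n --> \oo] --> 0%E.
    rewrite -(measure0 mu) -G0; apply: nonincreasing_cvg_mu => //.
    + apply: (@le_lt_trans _ _ (mu D)); last by rewrite lebesgue_cube ltry.
      by apply: le_measure; rewrite ?inE//; [exact: mD|move=> x []].
    + by rewrite G0.
    + move=> m n mn; apply/subsetPset; apply: setIS; apply: setDS.
      rewrite /U -!bigcup_mkord => x [k /= km Fk].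
      by exists k => //=; exact: leq_trans km mn.
  exists (\1_(U n)) => //; apply: le_trans Gn.
  rewrite /G setIC -L1_norm_indic//; last exact: measurableD.
  rewrite le_eqVlt; apply/orP; left; apply/eqP; apply: eq_L1_norm => x _.
  have [Ux|Ux] := boolP (x \in U n).
    rewrite !indicE Ux in_setD Ux andbF mem_set ?subrr//.
    by move: Ux; rewrite inE /U -bigcup_mkord => -[k _ Fkx]; exists k.
  by rewrite !indicE in_setD (negbTE Ux) andbT subr0.
Qed.

End grid_approximable.

(** * Densities are approximable by grid functions *)

Section density_approximable.
Import HBSimple.
Set Implicit Arguments.
Unset Strict Implicit.
Context (R : realType) (d : nat).
Local Notation mu := (@lebesgue_tuple R d).
Local Notation D := (@unit_cube R d).
Local Notation mD := (@measurable_unit_cube R d).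
Implicit Types f g h : euclid R d -> R.

(** Keep the cells whose lower end is at least t: this errs only on the slab of
    width 1/(n+1) above t. *)
Lemma grid_approximable_halfspace (j : 'I_d) (t : R) :
  grid_approximable_set [set x : euclid R d | t <= tnth x j].
Proof.
have mray (A : set (measurableTypeR R)) (B : set (euclid R d)) : measurable A ->
    B = [set x | A (tnth x j)] -> measurable B.
  by move=> mA ->; exact: measurable_slab.
have mA : measurable [set x : euclid R d | t <= tnth x j].
  apply: (@mray `[t, +oo[%classic); first exact: measurable_itv.
  by apply/seteqP; split=> x /=; rewrite in_itv /= andbT.
split=> //; split=> [|e e0]; first exact: measurable_indic.
exists (Num.truncn e^-1) => n Nn.
have n0 : 0 < n.+1%:R :> R by rewrite ltr0n.
have ne : n.+1%:R^-1 <= e.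
  rewrite -[leRHS]invrK lef_pV2 ?posrE ?invr_gt0//.
  apply: (le_trans (ltW (truncnS_gt _))); by rewrite ler_nat ltnS.
pose S := [set x : euclid R d | t <= tnth x j < t + n.+1%:R^-1].
have mS : measurable S.
  apply: (@mray `[t, t + n.+1%:R^-1[%classic); first exact: measurable_itv.
  by apply/seteqP; split=> x /=; rewrite in_itv.
pose v (c : {ffun 'I_d -> 'I_n.+1}) : R :=
  (t <= (c j)%:R / n.+1%:R)%R%:R.
exists v.
apply: (@le_trans _ _ (mu (D `&` S))); last first.
  apply: le_trans (lebesgue_slab _ _) _; first by rewrite lerDl invr_ge0 ltW.
  by rewrite lee_fin addrC addKr.
rewrite setIC -L1_norm_indic//; apply: L1_norm_le.
- by apply: (measurable_fun_sub_grid v); exact: measurable_indic.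
- exact: measurable_indic.
- move=> x Dx; have /andP[cx xc] := cell_index_itv n (Dx j).
  have memE (P : pred (euclid R d)) : (x \in [set y | P y]) = P x.
    by apply/idP/idP; rewrite inE.
  rewrite !indicE /v /grid ffunE (memE (fun y => t <= tnth y j)).
  rewrite (memE (fun y => t <= tnth y j < t + n.+1%:R^-1)).
  set c := _ / _ in cx xc *; set h := n.+1%:R^-1 in xc *.
  have [tx|tx] := leP t (tnth x j) => /=; have [tc|tc] := leP t c => /=;
    rewrite ?subrr ?normr0//.
  + have -> : tnth x j < t + h by rewrite (lt_trans xc)// ltrD2r.
    by rewrite subr0.
  + by have := lt_le_trans tx (le_trans tc cx); rewrite ltxx.
Qed.

(** Twice the same principle: the Borel sets B for which the cylinder over B
    is approximable form a sigma-algebra containing the rays, and the cylinders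
    generate the product sigma-algebra. *)
Lemma grid_approximable_measurable (A : set (euclid R d)) :
  measurable A -> grid_approximable_set A.
Proof.
have sL := @grid_approximable_sigma_algebra R d; have [L0 LC LU] := sL.
move: A; apply: (smallest_sub sL).
elim/big_ind: _ => // [G H GL HL A [/GL|/HL] //|j _ _ [B mB <-]].
rewrite setTI; move: B mB; rewrite RGenCInfty.measurableE.
apply: (@smallest_sub _ _ _ [set B : set R | grid_approximable_set
    ((fun x : euclid R d => tnth x j) @^-1` B)]).
  split.
  - by rewrite /= preimage_set0.
  - by move=> B /= /LC; rewrite !setTD preimage_setC.
  - by move=> F /= LF; rewrite preimage_bigcup; exact: LU.
move=> _ [t ->] /=.
rewrite (_ : _ @^-1` _ = [set x : euclid R d | t <= tnth x j]).
  exact: grid_approximable_halfspace.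
by apply/seteqP; split=> x /=; rewrite in_itv /= andbT.
Qed.

Lemma density_integrable (p : euclid R d -> R) : density d p ->
  mu.-integrable D (EFin \o p).
Proof.
move=> [mp p0 p1]; apply/integrableP; split; first exact/measurable_EFinP.
rewrite (eq_integral (fun x => (p x)%:E)).
  by rewrite p1 ltry.
by move=> x /set_mem Dx; rewrite /= ger0_norm// p0.
Qed.

Lemma density_approximable (p : euclid R d -> R) : density d p ->
  grid_approximable p.
Proof.
move=> dp; have [mp _ _] := dp; apply: grid_approximable_lim => // e e0.
have [g [_ _ gp]] := approximation_sfun_integrable mD (density_integrable dp).
have [n gn] := cvge0_le gp e0.
have [s gE] : exists s : seq R, (fun x => g n x) =
    (fun x => \sum_(y <- s) y * \1_(g n @^-1` [set y]) x).
  exists (finmap.enum_fset (fset_set (range (g n)))).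
  by apply/funext => x; rewrite fimfunE fsbig_finite.
exists (fun x => g n x); last by rewrite L1_normE.
rewrite gE; apply: grid_approximable_sum => y; apply: grid_approximableZ.
by apply: (grid_approximable_measurable _).2.
Qed.

End density_approximable.

(** * Histograms in coordinates *)

Section histograms.
Set Implicit Arguments.
Unset Strict Implicit.
Context (R : realType).

Definition weights (I : finType) (w : I -> R) :=
  (forall i, 0 <= w i) /\ \sum_i w i = 1.

(** For general f this collects repeated components of a mixture; for f
    injective it pads a mixture with components of weight zero. *)
Lemma sum_fiber (I J : finType) (f : I -> J) (w : I -> R) (G : J -> R) :
  \sum_j (\sum_(i | f i == j) w i) * G j = \sum_i w i * G (f i).
Proof.
rewrite (partition_big f xpredT)//=; apply: eq_bigr => j _.
by rewrite mulr_suml; apply: eq_bigr => i /eqP ->.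
Qed.

Lemma weights_fiber (I J : finType) (f : I -> J) (w : I -> R) : weights w ->
  weights (fun j => \sum_(i | f i == j) w i).
Proof.
move=> [w0 w1]; split=> [j|]; first exact: sumr_ge0.
by rewrite -w1 [RHS](partition_big f xpredT).
Qed.

(** A convex combination of cell densities may repeat cells; collecting the
    repetitions leaves one weight per cell. *)
Lemma hist1P b (f : R -> R) : hist1 b f <-> exists2 a : 'I_b -> R,
  weights a & f = (fun x => \sum_l a l * hist_cell l x).
Proof.
have sumE n (a : 'I_n -> R) (F : 'I_n -> R -> R^o) x :
    (\sum_i a i *: F i) x = \sum_i a i * F i x.
  by rewrite fct_sumE.
split=> [[n [w [F [[w0 w1] hF ->]]]]|[a [a0 a1] ->]].
  have /boolp.choice[s sE] : forall i, exists l : 'I_b, hist_cell l = F i.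
    by move=> i; have [l _ lE] := hF i; exists l.
  exists (fun l => \sum_(i | s i == l) w 0 i); first exact: weights_fiber.
  apply/funext => x; rewrite (sum_fiber s (w 0) (fun l => hist_cell l x)) sumE.
  by apply: eq_bigr => i _; rewrite sE.
exists b, (\row_l a l), (fun l => hist_cell l); split.
- split=> [i|]; first by rewrite mxE.
  by rewrite -a1; apply: eq_bigr => i _; rewrite mxE.
- by move=> i; exists i.
- by apply/funext => x; rewrite sumE; apply: eq_bigr => i _; rewrite mxE.
Qed.

Lemma hist1_value b (a : 'I_b.+1 -> R) x : 0 <= x < 1 ->
  \sum_l a l * hist_cell l x = b.+1%:R * a (cell_index b x).
Proof.
move=> x01; rewrite (bigD1 (cell_index b x))//= big1 ?addr0.
  by rewrite hist_cellE// eqxx mulr1 mulrC.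
by move=> l; rewrite hist_cellE// eq_sym => /negbTE ->; rewrite !mulr0.
Qed.

Context (d : nat).
Local Notation D := (@unit_cube R d).

(** A mixture indexed by any finite type with at most k elements: index it by
    numbers below k and give the remaining indices weight zero and an arbitrary
    component. *)
Lemma hist_weights b k (I : finType) (i0 : I) (w : I -> R)
    (P : I -> 'I_d -> R -> R) : (#|I| <= k)%N -> weights w ->
    (forall i j, hist1 b (P i j)) ->
  hist d b k (fun x => \sum_i w i * \prod_j P i j (tnth x j)).
Proof.
move=> Ik ww hP; pose f i := widen_ord Ik (enum_rank i).
have f_inj : injective f by move=> i i' /(congr1 val)/= /val_inj/enum_rank_inj.
pose g l := odflt i0 [pick i | f i == l].
have fK i : g (f i) = i.
  by rewrite /g; case: pickP => [i' /eqP/f_inj|/(_ i)] //=; rewrite eqxx.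
have [wf0 wf1] := weights_fiber f ww.
exists (\row_l \sum_(i | f i == l) w i), (fun l => P (g l)); split.
- split=> [l|]; first by rewrite mxE.
  by rewrite -wf1; apply: eq_bigr => l _; rewrite mxE.
- by move=> l j; exact: hP.
- apply/funext => x; under [RHS]eq_bigr do rewrite mxE.
  rewrite (sum_fiber f w (fun l => \prod_j P (g l) j (tnth x j))).
  by apply: eq_bigr => i _; rewrite fK.
Qed.

(** The value on cell c of the histogram with mixture weights w and bin weights
    a; each bin has width 1/(b+1), whence the factors b+1. *)
Definition multiview_value b k (w : 'I_k -> R)
    (a : 'I_k -> 'I_d -> 'I_b.+1 -> R) (c : {ffun 'I_d -> 'I_b.+1}) :=
  \sum_i w i * \prod_j (b.+1%:R * a i j (c j)).

Lemma histP b k (q : euclid R d -> R) : hist d b k q <->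
  exists (w : 'I_k -> R) (a : 'I_k -> 'I_d -> 'I_b -> R),
  [/\ weights w, forall i j, weights (a i j) &
    q = fun x => \sum_i w i * \prod_j \sum_l a i j l * hist_cell l (tnth x j)].
Proof.
split=> [[w [P [[w0 w1] hP ->]]]|[w [a [[w0 w1] wa ->]]]].
  have /boolp.choice[a aP] : forall ij, exists a : 'I_b -> R, weights a /\
      P ij.1 ij.2 = fun x => \sum_l a l * hist_cell l x.
    by move=> ij; have /hist1P[a] := hP ij.1 ij.2; exists a.
  exists (w 0), (fun i j => a (i, j)); split=> //.
    by move=> i j; have [] := aP (i, j).
  apply/funext => x; apply: eq_bigr => i _; congr (_ * _).
  by apply: eq_bigr => j _; have [_ /= ->] := aP (i, j).
exists (\row_i w i), (fun i j x => \sum_l a i j l * hist_cell l x); split.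
- split=> [i|]; first by rewrite mxE.
  by rewrite -w1; apply: eq_bigr => i _; rewrite mxE.
- by move=> i j; apply/hist1P; exists (a i j).
- by apply/funext => x; apply: eq_bigr => i _; rewrite mxE.
Qed.

Lemma multiview_valueE b k (w : 'I_k -> R)
    (a : 'I_k -> 'I_d -> 'I_b.+1 -> R) x : D x ->
  \sum_i w i * \prod_j \sum_l a i j l * hist_cell l (tnth x j) =
         multiview_value w a (grid b x).
Proof.
move=> Dx; apply: eq_bigr => i _; congr (_ * _); apply: eq_bigr => j _.
by rewrite hist1_value ?ffunE//; exact: Dx.
Qed.

Lemma measurable_fun_hist b k (q : euclid R d -> R) : hist d b.+1 k q ->
  measurable_fun D q.
Proof.
move=> /histP[w [a [_ _ ->]]].
apply: (eq_measurable_fun (fun x => multiview_value w a (grid b x))).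
  by move=> x /set_mem Dx; rewrite multiview_valueE.
exact: measurable_fun_grid.
Qed.

(** Every function constant on the cells is a combination of products of cell
    densities; the factor N^d is the height of one such product. *)
Lemma grid_functionE n (w : {ffun 'I_d -> 'I_n.+1} -> R) x : D x ->
  \sum_c w c * \prod_j hist_cell (c j) (tnth x j) =
  n.+1%:R ^+ d * w (grid n x).
Proof.
move=> Dx.
have prodE (c : {ffun 'I_d -> 'I_n.+1}) : \prod_j hist_cell (c j) (tnth x j) =
    n.+1%:R ^+ d * (grid n x == c)%:R :> R.
  under eq_bigr do rewrite hist_cellE ?Dx//.
  rewrite big_split /= prodr_const card_ord; congr (_ * _).
  have [<-|/eqP gc] := eqVneq (grid n x) c.
    by rewrite big1// => j _; rewrite ffunE eqxx.
  apply/eqP; rewrite prodf_seq_eq0; apply: contra_notT gc => /hasPn h.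
  apply/ffunP => j; rewrite ffunE; apply/eqP.
  by have := h j (mem_index_enum j); rewrite /= pnatr_eq0 eqb0 negbK.
rewrite (bigD1 (grid n x))//= [X in _ + X]big1 ?addr0.
  by rewrite prodE eqxx mulr1 mulrC.
by move=> c; rewrite prodE eq_sym => /negbTE ->; rewrite !mulr0.
Qed.

End histograms.

(** * Grid densities are close to fine histograms *)

Section approximation.
Set Implicit Arguments.
Unset Strict Implicit.
Context (R : realType).

(** Give each bin its exact mass under the uniform law on [i/N, (i+1)/N).  A bin
    inside this interval then gets height N, a bin outside gets 0, and only a
    bin with an end point in its interior gets an intermediate height. *)
Lemma hist1_approx_cell n b (i : 'I_n.+1) : exists2 h : R -> R, hist1 b.+1 h &
  forall x : R, 0 <= x < 1 -> 0 <= h x <= n.+1%:R /\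
    ((forall t : 'I_n.+2, b.+1%:R^-1 <= `|x - t%:R / n.+1%:R|) ->
     h x = hist_cell i x).
Proof.
set N : R := n.+1%:R; set B : R := b.+1%:R.
have N0 : 0 < N by rewrite ltr0n.
have B0 : 0 < B by rewrite ltr0n.
have [lo loE] : exists lo : R, i%:R / N = lo by eexists.
have [hi hiE'] : exists hi : R, lo + N^-1 = hi by eexists.
have Vn : 0 < N^-1 by rewrite invr_gt0.
have lohi : lo <= hi by rewrite -hiE' lerDl ltW.
have hiE : i.+1%:R / N = hi by rewrite -natr1 mulrDl mul1r loE.
have lo0 : 0 <= lo by rewrite -loE divr_ge0// ltW.
have hi1 : hi <= 1 by rewrite -hiE ler_pdivrMr// mul1r ler_nat.
pose clamp t := Num.min (Num.max t lo) hi.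
have clampL t : t <= lo -> clamp t = lo.
  by move=> ?; rewrite /clamp max_r// min_l.
have clampM t : lo <= t <= hi -> clamp t = t.
  by move=> /andP[? ?]; rewrite /clamp max_l// min_l.
have clampR t : hi <= t -> clamp t = hi.
  by move=> ?; rewrite /clamp min_r// le_max; apply/orP; left.
have clampD t s : 0 <= s -> 0 <= clamp (t + s) - clamp t <= s.
  move=> s0; rewrite /clamp.
  have [?|?] := leP t lo; have [?|?] := leP (t + s) lo; have [?|?] := leP t hi;
    have [?|?] := leP (t + s) hi;
    rewrite ?(min_l lohi); apply/andP; split; lra.
(* clamp is the retraction onto [lo, hi], so clamp v - clamp u is the length of
   the part of [u, v] inside [lo, hi]; the masses add up to 1 by telescoping. *)
pose a (l : 'I_b.+1) := N * (clamp (l.+1%:R / B) - clamp (l%:R / B)).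
have lS (l : nat) : l.+1%:R / B = l%:R / B + B^-1.
  by rewrite -natr1 mulrDl mul1r.
have VB : 0 < B^-1 by rewrite invr_gt0.
have a_ge0 l : 0 <= a l.
  rewrite mulr_ge0 ?(ltW N0)// lS.
  by have /andP[] := clampD (l%:R / B) _ (ltW VB).
exists (fun x => \sum_l a l * hist_cell l x).
  apply/hist1P; exists a => //; split=> //.
  rewrite -mulr_sumr -(big_mkord xpredT (fun l =>
    clamp (l.+1%:R / B) - clamp (l%:R / B))) telescope_sumr//.
  rewrite mul0r divff ?gt_eqF// (clampL 0)// (clampR 1)//.
  by rewrite -hiE' addrC addKr divff// gt_eqF.
move=> x x01; rewrite hist1_value//; set l := cell_index b x.
have /andP[lx xl] := cell_index_itv b x01; rewrite -/l -/B in lx xl.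
have dE : B * a l = N * (B * (clamp (l.+1%:R / B) - clamp (l%:R / B))).
  by rewrite mulrCA.
rewrite -/B dE; split.
  have /andP[d0 d1] : 0 <= clamp (l.+1%:R / B) - clamp (l%:R / B) <= B^-1.
    by rewrite lS clampD// ltW.
  rewrite !mulr_ge0 ?(ltW N0) ?(ltW B0)//= ger_pMr//.
  by rewrite -ler_pdivlMl// mulr1.
move=> far; have [u uE] : exists u : R, l%:R / B = u by eexists.
have [r rE] : exists r : R, B^-1 = r by eexists.
rewrite lS uE rE in lx xl VB far *; have flo := far (widen_ord (leqnSn _) i).
have fhi := far (lift ord0 i).
rewrite /= -/N loE in flo; rewrite /= /bump /= add1n hiE in fhi.
rewrite /hist_cell indicE mem_setE in_itv/= -/N loE hiE; congr (N * _).
have [xlo|lox] := leP lo x; last first.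
  rewrite ltr0_norm ?subr_lt0// in flo.
  by rewrite !clampL ?subrr ?mulr0//; lra.
rewrite ger0_norm ?subr_ge0// in flo.
have [xhi|hix] := ltP x hi.
  rewrite ltr0_norm ?subr_lt0// in fhi.
  have -> : clamp (u + r) - clamp u = r.
    by rewrite !clampM ?[_ + _ - _]addrC ?addKr//; lra.
  by rewrite -rE divff// gt_eqF.
rewrite ger0_norm ?subr_ge0// in fhi.
by rewrite !clampR ?subrr ?mulr0//; lra.
Qed.

Context (d : nat).
Local Notation mu := (@lebesgue_tuple R d).
Local Notation D := (@unit_cube R d).
Local Notation mD := (@measurable_unit_cube R d).

Lemma lebesgue_cell n (c : {ffun 'I_d -> 'I_n.+1}) :
  mu (D `&` grid n @^-1` [set c]) = (n.+1%:R ^- d)%:E.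
Proof.
have n0 : 0 < n.+1%:R :> R by rewrite ltr0n.
pose A i : set (measurableTypeR R) :=
  `[(c i)%:R / n.+1%:R, (c i).+1%:R / n.+1%:R[%classic.
have -> : D `&` grid n @^-1` [set c] = [set t | forall i, A i (tnth t i)].
  apply/seteqP; split=> x /=.
    by move=> [Dx gx] j; rewrite /A /= in_itv -gx ffunE/= -cell_indexE.
  move=> h; have Dx : D x.
    move=> j; have := h j; rewrite /A /= in_itv/= => /andP[h1 h2].
    rewrite (le_trans _ h1) ?divr_ge0//=; apply: (lt_le_trans h2).
    by rewrite ler_pdivrMr// mul1r ler_nat.
  split=> //; apply/ffunP => j; rewrite ffunE; apply/eqP.
  by rewrite cell_indexE ?Dx//; have := h j; rewrite /A /= in_itv.
rewrite lebesgue_tuple_box; last by move=> i; exact: measurable_itv.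
rewrite (eq_bigr (fun=> (n.+1%:R^-1)%:E)).
  by rewrite prodEFin prodr_const card_ord exprVn.
move=> i _; rewrite /A lebesgue_measure_itv/= lte_fin.
rewrite ltr_pM2r ?invr_gt0// ltr_nat ltnSn -EFinB -mulrBl.
by rewrite -natr1 addrC addKr mul1r.
Qed.

Lemma L1_norm_grid n (v : {ffun 'I_d -> 'I_n.+1} -> R) : (forall c, 0 <= v c) ->
  L1_norm (fun x => v (grid n x)) = (n.+1%:R ^- d * \sum_c v c)%:E.
Proof.
move=> v0; have mS c : measurable (D `&` grid n @^-1` [set c]).
  exact: measurable_grid.
pose F c x : R := v c * \1_(D `&` grid n @^-1` [set c]) x.
have mF c : measurable_fun D (\1_(D `&` grid n @^-1` [set c]) : _ -> R).
  exact: measurable_indic.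
rewrite (@eq_L1_norm _ _ _ (fun x => \sum_c F c x)); last first.
  move=> x Dx; rewrite (bigD1 (grid n x))//= big1 ?addr0.
    by rewrite /F indicE mem_set ?mulr1.
  move=> c gc; rewrite /F indicE memNset ?mulr0//= => -[_ gE].
  by rewrite gE eqxx in gc.
rewrite L1_norm_sum.
- rewrite mulr_sumr -sumEFin; apply: eq_bigr => c _.
  rewrite L1_normZ// L1_norm_indic//.
  by rewrite ger0_norm// -setIA [X in _ `&` X]setIC setIA setIid lebesgue_cell
    -EFinM mulrC.
- by move=> c; exact: measurable_funM.
- by move=> c x; rewrite mulr_ge0.
Qed.

End approximation.

Section density.
Set Implicit Arguments.
Unset Strict Implicit.
Context (R : realType) (d : nat).
Local Notation mu := (@lebesgue_tuple R d).
Local Notation D := (@unit_cube R d).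
Local Notation mD := (@measurable_unit_cube R d).

(** Truncating at 0 does not increase the distance to p, as p is nonnegative.
    The truncation then has integral Z with |Z - 1| <= e/2, and dividing by Z
    moves it by exactly |Z - 1|. *)
Lemma density_grid_approx (p : euclid R d -> R) (e : R) :
  density d p -> 0 < e ->
  exists n (w : {ffun 'I_d -> 'I_n.+1} -> R), weights w /\
    (L1_norm (fun x => p x - n.+1%:R ^+ d * w (grid n x))%R <= e%:E)%E.
Proof.
move=> dp e0; have [mp p0 p1] := dp.
(* The bound by 1 keeps Z away from 0. *)
pose e' := Num.min e 1 / 2.
have e'0 : 0 < e' by rewrite divr_gt0// lt_min e0 ltr01.
have e'e : e' + e' <= e by rewrite -splitr ge_min lexx.
have e'1 : e' < 1 by rewrite ltr_pdivrMr// mul1r gt_min ltr1n orbT.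
have [_ /(_ _ e'0)[n /(_ _ (leqnn _))[v pv]]] := density_approximable dp.
pose v' c := Num.max (v c) 0.
have v'0 c : 0 <= v' c by rewrite le_max lexx orbT.
have mv' : measurable_fun D (fun x => v' (grid n x)).
  exact: (measurable_fun_grid v').
have pv' : (L1_norm (fun x => p x - v' (grid n x))%R <= e'%:E)%E.
  apply: le_trans pv; apply: L1_norm_le.
  - exact: (measurable_fun_sub_grid v').
  - exact: measurable_fun_sub_grid.
  - move=> x Dx; rewrite /v'; have := p0 _ Dx.
    have [//|v0 px] := leP 0 (v (grid n x)).
    by rewrite subr0 !ger0_norm//; lra.
pose Z := n.+1%:R ^- d * \sum_c v' c.
have v'Z : L1_norm (fun x => v' (grid n x)) = Z%:E by exact: L1_norm_grid.
have Lp : L1_norm p = 1%E.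
  rewrite L1_normE -p1; apply: eq_integral => x /set_mem Dx.
  by rewrite ger0_norm// p0.
have Zge : 1 - e' <= Z.
  rewrite lerBlDl -lee_fin EFinD -v'Z -[leLHS]Lp.
  apply: le_trans (leeD pv' (lexx _)); apply: L1_normD => //.
    exact: (measurable_fun_sub_grid v').
  by move=> x _; rewrite -[X in `|X| <= _](subrK (v' (grid n x))) ler_normD.
have Zle : Z <= 1 + e'.
  rewrite -lee_fin -v'Z EFinD -[X in (X + _)%E]Lp.
  apply: le_trans (leeD (lexx _) pv'); apply: L1_normD => //.
    exact: (measurable_fun_sub_grid v').
  move=> x _; rewrite [`|p x - _|]distrC.
  have := ler_normD (p x) (v' (grid n x) - p x).
  by rewrite addrC subrK.
have Z0 : 0 < Z by apply: lt_le_trans Zge; rewrite subr_gt0.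
exists n, (fun c => n.+1%:R ^- d * v' c / Z); split.
  split=> [c|].
    by apply: divr_ge0; [rewrite mulr_ge0 ?invr_ge0|exact: ltW].
  by rewrite -mulr_suml -mulr_sumr divff// gt_eqF.
apply: le_trans (_ : _ <= (e' + e')%:E)%E _; last by rewrite lee_fin.
have -> : (fun x => p x - n.+1%:R ^+ d * (n.+1%:R ^- d * v' (grid n x) / Z)) =
    fun x => (p x - v' (grid n x)) + (1 - Z^-1) * v' (grid n x).
  apply/funext => x; rewrite !mulrA divff ?mul1r; last first.
    by rewrite expf_neq0// pnatr_eq0.
  by rewrite mulrBl mul1r addrA subrK [_^-1 * _]mulrC.
rewrite EFinD; apply: (@le_trans _ _ (L1_norm (fun x => p x - v' (grid n x))%R +
    L1_norm (fun x => (1 - Z^-1) * v' (grid n x))%R)%E).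
  apply: L1_normD.
  - apply: measurable_funD; first exact: (measurable_fun_sub_grid v').
    exact: measurable_funM.
  - exact: (measurable_fun_sub_grid v').
  - exact: measurable_funM.
  - by move=> x _; exact: ler_normD.
apply: leeD => //; rewrite L1_normZ// v'Z -EFinM lee_fin.
rewrite -[X in _ * X](gtr0_norm Z0) -normrM mulrBl mul1r mulVf ?gt_eqF//.
by rewrite ler_norml; apply/andP; split; lra.
Qed.

(** Off the slabs of half-width r around the grid hyperplanes every factor is
    reproduced exactly.  On them both functions lie in [0, M]. *)
Lemma hist_approx_grid n (w : {ffun 'I_d -> 'I_n.+1} -> R) (e : R) :
    weights w -> 0 < e ->
  exists K, forall k b, (K <= k)%N -> (K <= b)%N ->
    exists2 q, hist d b k q &
      (L1_norm (fun x => n.+1%:R ^+ d * w (grid n x) - q x)%R <= e%:E)%E.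
Proof.
move=> ww e0; pose M : R := n.+1%:R ^+ d.
have M0 : 0 <= M by rewrite exprn_ge0.
pose T := ('I_d * 'I_n.+2)%type.
pose C : R := M * 2 * #|{: T}|%:R.
exists (maxn #|{: {ffun 'I_d -> 'I_n.+1}}| (Num.truncn (C / e)).+1) => k b.
rewrite !geq_max => /andP[kn _] /andP[_].
case: b => // b; rewrite ltnS => Cb.
pose r : R := b.+1%:R^-1.
have r0 : 0 < r by rewrite invr_gt0.
have Cr : C * r <= e.
  rewrite ler_pdivrMr// mulrC -ler_pdivrMr// ltW//.
  by apply: (lt_le_trans (truncnS_gt _)); rewrite ler_nat ltnS.
have /boolp.choice[h hP] : forall i : 'I_n.+1, exists h : R -> R,
    hist1 b.+1 h /\ forall x : R, 0 <= x < 1 -> 0 <= h x <= n.+1%:R /\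
    ((forall t : 'I_n.+2, r <= `|x - t%:R / n.+1%:R|) -> h x = hist_cell i x).
  by move=> i; have [h h1 h2] := hist1_approx_cell R b i; exists h.
pose q (x : euclid R d) := \sum_c w c * \prod_j h (c j) (tnth x j).
have hq : hist d b.+1 k q.
  apply: (@hist_weights _ _ _ _ _ [ffun=> ord0] w (fun c j => h (c j))) => //.
  by move=> c j; have [] := hP (c j).
exists q => //.
have mq := measurable_fun_hist hq.
pose S (t : T) := [set x : euclid R d |
  t.2%:R / n.+1%:R - r <= tnth x t.1 < t.2%:R / n.+1%:R + r].
have mS t : measurable (S t).
  rewrite (_ : S t = [set x | `[t.2%:R / n.+1%:R - r,
      t.2%:R / n.+1%:R + r[%classic (tnth x t.1)]).
    by apply: measurable_slab; exact: measurable_itv.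
  by apply/seteqP; split=> x; rewrite /S /= in_itv.
pose F (t : T) (x : euclid R d) : R := M * \1_(S t) x.
have mF t : measurable_fun D (F t).
  by apply: measurable_funM => //; exact: measurable_indic.
have F0 t x : 0 <= F t x by rewrite mulr_ge0.
apply: (@le_trans _ _ (L1_norm (fun x => \sum_t F t x)%R)); last first.
  rewrite L1_norm_sum//.
  apply: le_trans (_ : _ <= \sum_(t : T) (M * (2 * r))%:E)%E _.
    apply: lee_sum => t _; rewrite L1_normZ; last exact: measurable_indic.
    rewrite ger0_norm// L1_norm_indic// EFinM lee_wpmul2l// setIC.
    rewrite /S; move: (t.2%:R / n.+1%:R) => a.
    apply: le_trans (lebesgue_slab _ _) _; first by lra.
    by rewrite lee_fin; lra.
  rewrite sumEFin lee_fin sumr_const -[X in X <= _]mulr_natr.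
  by apply: le_trans Cr; rewrite /C mulrA mulrAC.
apply: L1_norm_le.
- apply: measurable_funB => //.
  exact: (measurable_fun_grid (fun c => n.+1%:R ^+ d * w c)).
- by apply: measurable_sum.
move=> x Dx; rewrite [leRHS]ger0_norm ?sumr_ge0//.
have q_itv : 0 <= q x <= M.
  have hb c : 0 <= \prod_j h (c j) (tnth x j) <= M.
    rewrite prodr_ge0 => [|j _]; last first.
      by have [_ /(_ _ (Dx j))[/andP[]]] := hP (c j).
    rewrite /M -[X in _ ^+ X](card_ord d) -prodr_const.
    by apply: ler_prod => j _; have [_ /(_ _ (Dx j))[]] := hP (c j).
  have [w0 w1] := ww; rewrite sumr_ge0 => [|c _]; last first.
    by rewrite mulr_ge0//; have /andP[] := hb c.
  rewrite -[leRHS]mul1r -w1 mulr_suml; apply: ler_sum => c _.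
  by rewrite ler_wpM2l//; have /andP[] := hb c.
have u_itv : 0 <= n.+1%:R ^+ d * w (grid n x) <= M.
  have [w0 w1] := ww; rewrite mulr_ge0//= -[leRHS]mulr1 ler_wpM2l// -w1.
  by rewrite (bigD1 (grid n x))//= lerDl sumr_ge0.
have [[t xt]|noS] := pselect (exists t, S t x).
  rewrite (bigD1 t)//= {1}/F indicE mem_set// mulr1.
  apply: ler_wpDr; first exact: sumr_ge0.
  by rewrite ler_norml; apply/andP; split; lra.
suff -> : n.+1%:R ^+ d * w (grid n x) = q x by rewrite subrr normr0 sumr_ge0.
rewrite -grid_functionE//; apply: eq_bigr => c _; congr (_ * _).
apply: eq_bigr => j _; have [_ /(_ _ (Dx j))[_ ->//]] := hP (c j).
move=> t; rewrite leNgt; apply/negP; rewrite ltr_distl => xt.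
by apply: noS; exists (j, t); rewrite /S /=; move: xt => /andP[/ltW-> ->].
Qed.

Lemma density_hist_approx (p : euclid R d -> R) (e : R) :
  density d p -> 0 < e ->
  exists K, forall k b, (K <= k)%N -> (K <= b)%N ->
    exists2 q, hist d b k q & (L1_norm (p \- q)%R <= e%:E)%E.
Proof.
move=> dp e0; have [mp _ _] := dp; have e20 : 0 < e / 2 by rewrite divr_gt0.
have [n [w [ww pw]]] := density_grid_approx dp e20.
have [K hK] := hist_approx_grid ww e20.
exists K.+1 => k [//|b] Kk Kb.
have [q hq wq] := hK _ b.+1 (ltnW Kk) (ltnW Kb); exists q => //.
have mw : measurable_fun D (fun x => n.+1%:R ^+ d * w (grid n x)).
  exact: (measurable_fun_grid (fun c => n.+1%:R ^+ d * w c)).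
have mq := measurable_fun_hist hq.
rewrite (splitr e) EFinD; apply: le_trans (leeD pw wq).
apply: L1_normD; [exact: measurable_funB..|].
move=> x _; rewrite (le_trans _ (ler_normD _ _))// addrA subrK//.
Qed.

End density.

(** * Existence of a best approximation *)

Section minimum.
Set Implicit Arguments.
Unset Strict Implicit.
Context (R : realType).

Lemma weights_le1 (I : finType) (w : I -> R) i : weights w -> w i <= 1.
Proof. by move=> [w0 <-]; rewrite (bigD1 i)//= lerDl sumr_ge0. Qed.

Lemma weights_point (I : finType) (i0 : I) :
  weights (fun i => (i == i0)%:R : R).
Proof.
split=> [i|]; first exact: ler0n.
by rewrite (bigD1 i0)//= eqxx big1 ?addr0// => i /negbTE ->.
Qed.

(** The simplex as a closed condition, for weights depending continuously on a
    parameter. *)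
Lemma closed_weights (T : topologicalType) (I : finType) (w : I -> T -> R) :
  (forall i, continuous (w i)) -> closed [set t | weights (fun i => w i t)].
Proof.
move=> cw; have -> : [set t | weights (fun i => w i t)] =
    (\bigcap_i (w i @^-1` [set x | 0 <= x])) `&`
    (fun t => \sum_i w i t) @^-1` [set x | x = 1].
  by apply/seteqP; split=> t /= [h1 h2]; split=> // i; [move=> _|]; exact: h1.
apply: closedI.
  apply: closed_bigI => i _; apply: preimage_closed; last exact: closed_ge.
  by move=> t _; exact: cw.
apply: preimage_closed; last exact: closed_eq.
move=> t _; apply: (continuous_big (op := +%R)); first exact: add_continuous.
by move=> i _; exact: cw.
Qed.

Lemma cvge0_ge0 (T : Type) (F : set_system T) (u : T -> \bar R) : Filter F ->
    (forall t, 0 <= u t)%E ->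
    (forall e : R, 0 < e -> \forall t \near F, (u t <= e%:E)%E) ->
  u t @[t --> F] --> 0%E.
Proof.
move=> FF u0 ule; apply/fine_cvgP; split.
  apply: filterS (ule 1 ltr01) => t ut.
  by rewrite ge0_fin_numE// (le_lt_trans ut)// ltry.
apply/cvgrPdist_le => e e0; apply: filterS (ule e e0) => t ut.
rewrite /= sub0r normrN ger0_norm ?fine_ge0//.
by rewrite -lee_fin fineK// ge0_fin_numE// (le_lt_trans ut)// ltry.
Qed.

Context (d : nat).
Local Notation D := (@unit_cube R d).
Local Notation mD := (@measurable_unit_cube R d).

(** The cube has measure 1, so a uniform bound on the change of the grid
    function is a bound on the change of the error. *)
Lemma L1_norm_sub_grid_le b (p : euclid R d -> R)
    (v v' : {ffun 'I_d -> 'I_b.+1} -> R) (e : R) : measurable_fun D p ->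
    (forall c, `|v c - v' c| <= e) ->
  (L1_norm (fun x => p x - v' (grid b x))%R <=
    L1_norm (fun x => p x - v (grid b x))%R + e%:E)%E.
Proof.
move=> mp vv'.
have e0 : 0 <= e by apply: le_trans (vv' [ffun=> ord0]).
have -> : e%:E = @L1_norm R d (fun=> e) by rewrite L1_norm_cst ger0_norm.
apply: L1_normD; try exact: measurable_fun_sub_grid.
  exact: measurable_cst.
move=> x _; rewrite (ger0_norm e0).
apply: (@le_trans _ _ (`|p x - v (grid b x)| +
    `|v (grid b x) - v' (grid b x)|)).
  by rewrite (le_trans _ (ler_normD _ _))// addrA subrK.
by rewrite lerD2l.
Qed.

Lemma L1_norm_sub_grid_fin b (p : euclid R d -> R)
    (v : {ffun 'I_d -> 'I_b.+1} -> R) : density d p ->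
  L1_norm (fun x => p x - v (grid b x)) \is a fin_num.
Proof.
move=> dp; have [mp _ _] := dp.
rewrite ge0_fin_numE; last by rewrite L1_normE; exact: integral_ge0.
apply: (@le_lt_trans _ _
    (L1_norm (fun x => p x - 0)%R + (\sum_c `|v c|)%:E)%E).
  apply: (@L1_norm_sub_grid_le _ _ (fun=> 0)) => // c.
  by rewrite sub0r normrN (bigD1 c)//= lerDl sumr_ge0.
apply: lte_add_pinfty; last exact: ltry.
under [X in L1_norm X]eq_fun do rewrite subr0.
rewrite L1_normE.
by have /integrableP[_] := density_integrable dp.
Qed.

Lemma continuous_grid_error b (p : euclid R d -> R) (T : topologicalType)
    (V : T -> {ffun 'I_d -> 'I_b.+1} -> R) : density d p ->
    (forall c, continuous (fun t => V t c)) ->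
  continuous (fun t => fine (L1_norm (fun x => p x - V t (grid b x)))).
Proof.
move=> dp cV t; have [mp _ _] := dp.
set F := fun t => fine _.
have Fle (e : R) u u' : (forall c, `|V u c - V u' c| <= e) -> F u' <= F u + e.
  move=> uu'; rewrite -lee_fin EFinD !fineK; try exact: L1_norm_sub_grid_fin.
  exact: L1_norm_sub_grid_le.
apply/(@cvgrPdist_le R R T (nbhs t) _ F (F t)) => e e0.
have : \forall s \near t, forall c, `|V t c - V s c| <= e.
  apply: filter_forall => c; have /cvgrPdist_le := cV c t; exact.
apply: filterS => s ts.
have h1 : F s <= F t + e by exact: Fle.
have h2 : F t <= F s + e by apply: Fle => c; rewrite distrC.
by rewrite ler_norml; apply/andP; split; lra.
Qed.

(** The parameters, w i at inl i and a i j l at inr (i, j, l), are points of a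
    finite power of R with the product topology.  Tychonoff makes the cube of
    entries in [0, 1] compact, and the simplex conditions are closed in it. *)
Lemma hist_min k b (p : euclid R d -> R) :
    density d p -> (0 < k)%N -> (0 < b)%N ->
  exists2 q0, hist d b k q0 &
    forall q, hist d b k q -> (L1_norm (p \- q0)%R <= L1_norm (p \- q)%R)%E.
Proof.
case: b => // b; case: k => // k dp _ _.
pose J := ('I_k.+1 + 'I_k.+1 * 'I_d * 'I_b.+1)%type.
pose T := {ptws J -> R}.
pose W (t : T) i := t (inl i); pose A (t : T) i j l := t (inr (i, j, l)).
pose Q (t : T) (x : euclid R d) :=
  \sum_i W t i * \prod_j \sum_l A t i j l * hist_cell l (tnth x j).
pose V (t : T) := multiview_value (W t) (A t).
pose F (t : T) := fine (L1_norm (fun x => p x - V t (grid b x))).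
have FE t : (F t)%:E = L1_norm (p \- Q t).
  rewrite fineK; last exact: L1_norm_sub_grid_fin.
  by apply: eq_L1_norm => x Dx /=; rewrite /Q (multiview_valueE (W t) (A t) Dx).
pose K : set T := [set t | weights (W t)] `&`
  \bigcap_ij [set t | weights (A t ij.1 ij.2)].
have ct i : continuous (fun t : T => t i).
  exact: (@proj_continuous J (fun=> R) i).
have cK : compact K.
  apply: (@subclosed_compact _ _ [set t : T | forall i, `[0, 1]%classic (t i)]).
  - rewrite /K; apply: closedI; first by apply: closed_weights => i; exact: ct.
    by apply: closed_bigI => ij _; apply: closed_weights => l; exact: ct.
  - apply: (@tychonoff J (fun=> R) (fun=> `[0, 1]%classic)) => i.
    exact: segment_compact.
  - move=> t [wW wA] [i|[[i j] l]]; rewrite /= in_itv/=.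
      by rewrite wW.1 (weights_le1 i wW).
    by have wa := wA (i, j) I; rewrite wa.1 (weights_le1 l wa).
have K0 : K !=set0.
  exists (fun s => match s with inl i => (i == ord0)%:R
                   | inr (_, l) => (l == ord0)%:R end).
  by split=> [|[i j] _]; exact: weights_point.
have cV c : continuous (fun t => V t c).
  apply: (continuous_big (op := +%R)); first exact: add_continuous.
  have cA i j : continuous (fun t : T => b.+1%:R * t (inr (i, j, c j))).
    by move=> t; exact: (continuousM (@cst_continuous _ _ _ t) (ct _ t)).
  have cP i := @continuous_big R 'I_d *%R 1 xpredT (@mul_continuous R) T
    (index_enum _) _ (fun j _ => cA i j).
  by move=> i _ t; exact: (continuousM (ct (inl i) t) (cP i t)).
have cF : continuous F by exact: continuous_grid_error.
have [t tK Ft] := compact_EVT_min K0 cK (continuous_subspaceT cF).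
have [wW wA] : K t by rewrite inE in tK.
exists (Q t).
  by apply/histP; exists (W t), (A t); split=> // i j; exact: (wA (i, j)).
move=> _ /histP[w [a [ww wa ->]]].
pose s : T := fun s => match s with inl i => w i | inr (i, j, l) => a i j l end.
rewrite -FE -[leRHS](FE s) lee_fin; apply: Ft.
by rewrite inE; split=> // -[i j] _; exact: wa.
Qed.

End minimum.

Theorem lemma2p1 (R : realType) (d : nat) (hd : (0 < d)%N)
    (p : euclid R d -> R) (hp : density d p) :
  exists m : nat -> nat -> \bar R,
    (forall k b : nat, (0 < k)%N -> (0 < b)%N ->
       let errors := [set L1_norm (p \- q) | q in hist d b k] in
       errors (m k b) /\ lbound errors (m k b)) /\
    m kb.1 kb.2 @[kb --> (\oo, \oo)] --> 0%E.
Proof.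
exists (fun k b => ereal_inf [set L1_norm (p \- q) | q in hist d b k]).
split=> [k b k0 b0 errors|].
  split; last by move=> y; exact: ereal_inf_lbound.
  have [q0 hq0 minq0] := hist_min hp k0 b0; exists q0 => //.
  apply/eqP; rewrite eq_le; apply/andP; split.
    by apply: le_ereal_inf_tmp => _ [q hq <-]; exact: minq0.
  by apply: ereal_inf_lbound; exists q0.
apply: cvge0_ge0 => [[k b]|e e0] /=.
  apply: le_ereal_inf_tmp => _ [q _ <-].
  by rewrite L1_normE; exact: integral_ge0.
have [K hK] := density_hist_approx hp e0.
exists ([set k | (K <= k)%N], [set b | (K <= b)%N]).
  by split; exact: nbhs_infty_ge.
move=> [k b] [/= Kk Kb]; have [q hq pq] := hK _ _ Kk Kb.
by apply: le_trans pq; apply: ereal_inf_lbound; exists q.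
Qed.
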